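(* Let $q\in(0,1)$ and $s\in(0,1)$. Then $$\lim_{x \rightarrow \infty}\frac{\Gamma_{q}(x+s)}{[x]_q^{s}\,\Gamma_{q}(x)}=1.$$
   Context: Here $q$ and $s$ are fixed and $x\to\infty$ through positive reals. For $q\in(0,1)$ and real $x$, $[x]_q=\frac{1-q^x}{1-q}$, and $[x]_q^s$ means $([x]_q)^s$. The $q$-deformed Gamma function is defined for $q\in(0,1)$ and $x>0$ by $$\Gamma_q(x)=(1-q)^{1-x}\prod_{n=0}^{\infty}\frac{1-q^{n+1}}{1-q^{n+x}},$$ equivalently by the Jackson integral $\Gamma_q(x)=\int_0^{1/(1-q)} t^{x-1}E_q^{-qt}\,d_qt$, where $\int_0^a f(t)\,d_qt=(1-q)a\sum_{n=0}^\infty f(aq^n)q^n$ and $E_q^{t}=\prod_{i=0}^{\infty}(1+(1-q)tq^i)$. *)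

(* Defs.v *)
From HB Require Import structures.
From mathcomp Require Import all_boot all_order all_algebra.
From mathcomp Require Import all_classical all_reals all_analysis.

Set Implicit Arguments.
Unset Strict Implicit.
Unset Printing Implicit Defensive.

Import Order.TTheory GRing.Theory Num.Theory.
Import numFieldNormedType.Exports.

Local Open Scope classical_set_scope.
Local Open Scope ring_scope.

Section QGamma.
Variable R : realType.
Implicit Types q x : R.

Definition qnumber q x : R := (1 - q `^ x) / (1 - q).

(* Meant for 0 < q < 1 and 0 < x, where no denominator vanishes and the
   partial products converge; elsewhere the value is junk. *)
Definition qGamma q x : R :=
  (1 - q) `^ (1 - x) *
  limn (fun N : nat =>
    \prod_(0 <= n < N) ((1 - q ^+ n.+1) / (1 - q `^ (n%:R + x)))).

End QGamma.

(* Main.v *)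
Require Import Defs.
From mathcomp Require Import all_boot all_order all_algebra.
From mathcomp Require Import all_classical all_reals all_analysis.
From mathcomp Require Import ring lra.
Import Order.TTheory GRing.Theory Num.Theory.
Import numFieldNormedType.Exports.
Local Open Scope classical_set_scope.
Local Open Scope ring_scope.

(** The powers of [1 - q] cancel, so the quotient equals
    [L (x + s) / L x / (1 - q^x)^s], where [L] is the infinite product in the
    definition of Gamma_q.  Termwise, [L (x + s) / L x] is the product of the
    [(1 - q^(n+x)) / (1 - q^(n+x+s))], which is at most [1] and at least
    [\prod_n (1 - q^(n+x)) >= exp (- q^x / (1 - q)^2)].  As
    [1 - q^x <= (1 - q^x)^s <= 1], the quotient is squeezed between
    [exp (- q^x / (1 - q)^2)] and [1 / (1 - q^x)]. *)

Section QGammaAsymptotics.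
Variables (R : realType) (q : R).
Hypotheses (q_gt0 : 0 < q) (q_lt1 : q < 1).

Local Ltac qlra := move: q_gt0 q_lt1; lra.

Let q_ge0 : 0 <= q := ltW q_gt0.
Let q_le1 : q <= 1 := ltW q_lt1.

Lemma exprn_base_le1 (n : nat) : q ^+ n <= 1.
Proof. exact: exprn_ile1. Qed.

(** Kept syntactically equal to the sequence inside [qGamma], so that its limit can be folded
    there. *)
Let pprod (x : R) (N : nat) : R :=
  \prod_(0 <= n < N) ((1 - q ^+ n.+1) / (1 - q `^ (n%:R + x))).

Lemma powR_base_lt1 (x : R) : 0 < x -> q `^ x < 1.
Proof.
by move=> x0; rewrite /powR gt_eqF// expR_lt1 pmulr_rlt0// ln_lt0// q_gt0.
Qed.

Lemma powR_natD (n : nat) (x : R) : q `^ (n%:R + x) = q `^ x * q ^+ n.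
Proof.
by rewrite powRD ?(gt_eqF q_gt0) ?implybT// powR_mulrn ?ltW// mulrC.
Qed.

Lemma cvg_powR_base_lt1 : q `^ x @[x --> +oo] --> (0 : R).
Proof.
have -> : powR q = fun x => expR (- ((- ln q) * x)).
  by apply/funext => x; rewrite /powR gt_eqF// mulNr opprK mulrC.
have lnq : 0 < - ln q by rewrite oppr_gt0 ln_lt0// q_gt0.
apply: (@cvg_comp _ _ _ (fun x => - ln q * x) (fun y : R => expR (- y)) _ +oo).
  exact: gt0_cvgMry.
exact: cvgr_expR.
Qed.

(** Taking inverses, 1 / (1 - u) = 1 + u / (1 - u) <= 1 + u / (1 - q) <= exp (u / (1 - q)); the
    condition u <= q makes the constant uniform in u. *)
Lemma one_sub_ge_expR (u : R) : 0 <= u <= q -> expR (- (u / (1 - q))) <= 1 - u.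
Proof.
move=> /andP[u0 uq].
have u1 : 0 < 1 - u by qlra.
rewrite expRN -[leRHS]invrK lef_pV2 ?posrE ?invr_gt0 ?expR_gt0//.
apply: le_trans (expR_ge1Dx _).
have q1 : 0 < 1 - q by qlra.
have -> : (1 - u)^-1 = 1 + u / (1 - u) by field; qlra.
by rewrite lerD2l ler_wpM2l// lef_pV2 ?posrE//; qlra.
Qed.

(* The factor bounds telescope, because
   [t q^n / (1 - q) = t / (1 - q)^2 * (q^n - q^(n+1))]. *)
Lemma prod_geometric_ge_expR (t : R) (N : nat) : 0 <= t <= q ->
  expR (- (t / (1 - q) ^+ 2)) <= \prod_(0 <= n < N) (1 - t * q ^+ n).
Proof.
move=> /andP[t0 tq].
have q1 : 0 < 1 - q by qlra.
have t2 : 0 <= t / (1 - q) ^+ 2 by rewrite divr_ge0// exprn_ge0// ltW.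
(* The induction needs the exact partial sum, hence the sharper bound with the factor 1 - q^N <=
   1. *)
apply: (@le_trans _ _ (expR (- (t / (1 - q) ^+ 2 * (1 - q ^+ N))))).
  rewrite ler_expR lerN2 ler_piMr//.
  have := exprn_ge0 N (ltW q_gt0); qlra.
elim: N => [|N IH]; first by rewrite big_nil expr0 subrr mulr0 oppr0 expR0.
rewrite big_nat_recr//=.
have -> : - (t / (1 - q) ^+ 2 * (1 - q ^+ N.+1)) =
  - (t / (1 - q) ^+ 2 * (1 - q ^+ N)) + - (t * q ^+ N / (1 - q)).
  by rewrite (exprS q); field; qlra.
rewrite expRD ler_pM ?expR_ge0// one_sub_ge_expR//.
have qN : 0 <= q ^+ N <= 1.
  by rewrite exprn_ge0//= exprn_base_le1.
by rewrite mulr_ge0//=; [move: q_gt0 q_lt1; nra|qlra].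
Qed.

Lemma powR_nat_lt1 (n : nat) (x : R) : 0 < x -> q `^ (n%:R + x) < 1.
Proof. by move=> x0; apply: powR_base_lt1; rewrite ltr_wpDl. Qed.

Lemma pprod_ge0 (x : R) (N : nat) : 0 < x -> 0 <= pprod x N.
Proof.
move=> x0; apply: prodr_ge0 => n _; apply: divr_ge0; rewrite subr_ge0.
  by rewrite exprn_base_le1.
exact/ltW/powR_nat_lt1.
Qed.

(** For x >= 1, q^(n+x) <= q^(n+1), so every factor is at most 1. Restricting to x >= 1 costs
    nothing as x tends to infinity. *)
Lemma pprod_nonincreasing (x : R) : 1 <= x ->
  {homo pprod x : n m / (n <= m)%N >-> m <= n}.
Proof.
move=> x1; apply/nonincreasing_seqP => N.
have x0 : 0 < x by qlra.
rewrite /pprod big_nat_recr//= ler_piMr//; first exact: pprod_ge0.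
rewrite ler_pdivrMr ?subr_gt0 ?powR_nat_lt1// mul1r lerB//.
rewrite powR_natD exprS ler_wpM2r ?exprn_ge0//.
by rewrite ge1r_powR// q_gt0.
Qed.

Lemma pprod_cvg (x : R) : 1 <= x -> cvgn (pprod x).
Proof.
move=> x1; apply: nonincreasing_is_cvgn; first exact: pprod_nonincreasing.
exists 0 => _ [N _ <-]; apply: pprod_ge0; qlra.
Qed.

(** Allows division by the limit. The denominators are at most 1, so the partial products dominate
    those of the 1 - q^(n+1), which are bounded below by the geometric estimate at t = q. *)
Lemma pprod_lim_gt0 (x : R) : 1 <= x -> 0 < limn (pprod x).
Proof.
move=> x1; apply: lt_le_trans (expR_gt0 (- (q / (1 - q) ^+ 2))) _.
apply: limr_ge; first exact: pprod_cvg.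
near=> N; apply: (@le_trans _ _ (\prod_(0 <= n < N) (1 - q * q ^+ n))).
  by apply: prod_geometric_ge_expR; rewrite lexx ltW.
have x0 : 0 < x by qlra.
apply: ler_prod => n _; rewrite -exprS subr_ge0 exprn_base_le1//=.
have d0 : 0 < 1 - q `^ (n%:R + x) by rewrite subr_gt0 powR_nat_lt1.
rewrite ler_pdivlMr// ler_piMr ?subr_ge0 ?exprn_base_le1//.
by have := powR_ge0 q (n%:R + x); qlra.
Unshelve. all: by end_near. Qed.

Lemma pprod_shift_le (x s : R) (N : nat) : 0 < x -> 0 <= s ->
  pprod (x + s) N <= pprod x N.
Proof.
move=> x0 s0; apply: ler_prod => n _.
have nq : 0 <= 1 - q ^+ n.+1 by rewrite subr_ge0 exprn_base_le1.
have d0 : 0 < 1 - q `^ (n%:R + x) by rewrite subr_gt0 powR_nat_lt1.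
have ds0 : 0 < 1 - q `^ (n%:R + (x + s)).
  by rewrite subr_gt0 powR_nat_lt1//; qlra.
rewrite divr_ge0 ?(ltW ds0)//= ler_wpM2l// lef_pV2 ?posrE// lerB//.
by rewrite ger_powR ?q_gt0//; qlra.
Qed.

Lemma pprod_shift_ge (x s : R) (N : nat) : 1 <= x -> 0 <= s ->
  expR (- (q `^ x / (1 - q) ^+ 2)) * pprod x N <= pprod (x + s) N.
Proof.
move=> x1 s0; have x0 : 0 < x by qlra.
apply: (@le_trans _ _ (\prod_(0 <= n < N) (1 - q `^ x * q ^+ n) * pprod x N)).
  rewrite ler_wpM2r ?pprod_ge0//; apply: prod_geometric_ge_expR.
  by rewrite powR_ge0 ge1r_powR// q_gt0.
rewrite -big_split/=; apply: ler_prod => n _; rewrite -powR_natD.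
have nq : 0 <= 1 - q ^+ n.+1 by rewrite subr_ge0 exprn_base_le1.
have d0 : 0 < 1 - q `^ (n%:R + x) by rewrite subr_gt0 powR_nat_lt1.
have ds0 : 0 < 1 - q `^ (n%:R + (x + s)).
  by rewrite subr_gt0 powR_nat_lt1//; qlra.
(* The factor 1 - q^(n+x) cancels the denominator for x; the denominator for x + s is at most 1, so
   dividing by it only increases the term. *)
rewrite mulrCA mulfV ?gt_eqF// mulr1 nq/= ler_pdivlMr// ler_piMr//.
by have := powR_ge0 q (n%:R + (x + s)); qlra.
Qed.

Lemma qGamma_quotientE (x s : R) : 1 <= x ->
  qGamma q (x + s) / (qnumber q x `^ s * qGamma q x) =
  limn (pprod (x + s)) / limn (pprod x) / (1 - q `^ x) `^ s.
Proof.
move=> x1; have x0 : 0 < x by qlra.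
rewrite /qGamma /qnumber -/(pprod _) -/(pprod _).
have q1 : 0 < 1 - q by qlra.
have qx : 0 < 1 - q `^ x by rewrite subr_gt0 powR_base_lt1.
have L0 := pprod_lim_gt0 _ x1.
(* This extracts (1 - q)^(-s) from [x]_q^s, to match the one split off from (1 - q)^(1 - (x + s))
   below. *)
rewrite powRM ?invr_ge0 ?ltW// -(powR_inv1 (ltW q1)) -powRrM mulN1r.
have -> : 1 - (x + s) = (1 - x) + - s by ring.
rewrite powRD ?(gt_eqF q1) ?implybT//.
have p1 := powR_gt0 (- s) q1.
have p2 := powR_gt0 (1 - x) q1.
have p3 := powR_gt0 s qx.
by field; rewrite !gt_eqF.
Qed.

Lemma qGamma_quotient_bounds (x s : R) : 1 <= x -> 0 <= s <= 1 ->
  expR (- (q `^ x / (1 - q) ^+ 2)) <=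
    qGamma q (x + s) / (qnumber q x `^ s * qGamma q x) <= (1 - q `^ x)^-1.
Proof.
move=> x1 /andP[s0 s1]; have x0 : 0 < x by qlra.
rewrite qGamma_quotientE//.
have L0 := pprod_lim_gt0 _ x1.
have xs1 : 1 <= x + s by qlra.
have qx : 0 < 1 - q `^ x <= 1.
  by rewrite subr_gt0 powR_base_lt1//=; have := powR_ge0 q x; qlra.
have /andP[qx0 qx1] := qx.
have p_gt0 := powR_gt0 s qx0.
(* A base in (0, 1] has powers nonincreasing in the exponent; compare the exponents 0 <= s <= 1. *)
have p_le1 : (1 - q `^ x) `^ s <= 1.
  by rewrite -[leRHS](powRr0 (1 - q `^ x)) ger_powR.
have p_ge : 1 - q `^ x <= (1 - q `^ x) `^ s.
  by rewrite -[leLHS](powRr1 (ltW qx0)) ger_powR.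
have hi : limn (pprod (x + s)) / limn (pprod x) <= 1.
  rewrite ler_pdivrMr// mul1r; apply: ler_lim; try exact: pprod_cvg.
  by near=> N; exact: pprod_shift_le.
have lo : expR (- (q `^ x / (1 - q) ^+ 2)) <=
    limn (pprod (x + s)) / limn (pprod x).
  rewrite ler_pdivlMr//.
  apply: (ler_cvg_to (cvgMl_tmp (pprod_cvg _ x1)) (pprod_cvg _ xs1)).
  by near=> N; exact: pprod_shift_ge.
have r_ge0 := le_trans (expR_ge0 _) lo.
apply/andP; split.
  by apply: (le_trans lo); rewrite ler_peMr// invf_ge1.
rewrite -[leRHS]mul1r ler_pM ?invr_ge0 ?(ltW p_gt0)//.
by rewrite lef_pV2 ?posrE.
Unshelve. all: by end_near. Qed.

End QGammaAsymptotics.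

Theorem mainTheorem3 (R : realType) (q s : R)
    (hq0 : 0 < q) (hq1 : q < 1) (hs0 : 0 < s) (hs1 : s < 1) :
  qGamma q (x + s) / (qnumber q x `^ s * qGamma q x) @[x --> +oo] --> (1 : R).
Proof.
have q0 := cvg_powR_base_lt1 _ _ hq0 hq1.
(* Both bounds depend on x only through q^x, which tends to 0, so they tend to exp 0 and 1 / 1. *)
apply: (@squeeze_cvgr _ _ _ _
  (fun x => expR (- (q `^ x / (1 - q) ^+ 2))) (fun x => (1 - q `^ x)^-1)).
- near=> x; apply: qGamma_quotient_bounds;
    rewrite ?hq0 ?(ltW hs0) ?(ltW hs1)//.
- rewrite -[X in _ --> X]expR0; apply: continuous_cvg.
    exact: continuous_expR.
  rewrite -[X in _ --> X]oppr0 -[X in _ --> - X](mul0r ((1 - q) ^+ 2)^-1).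
  by apply: cvgN; exact: cvgMr_tmp.
- rewrite -[X in _ --> X]invr1; apply: cvgV; first exact: oner_neq0.
  by rewrite -[X in _ --> X]subr0; apply: cvgB => //; exact: cvg_cst.
Unshelve. all: by end_near. Qed.
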